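(* Let $\mathcal{P}_n$ denote the set of tilings of the $n\times n$ square grid by $n$-ominoes. Then $|\mathcal{P}_n| \ge (3^{1/6}-o(1))^{n^2}$; that is, there is a function $g:\mathbb{N}\to\mathbb{R}$ with $g(n)\to 0$ as $n\to\infty$ such that $|\mathcal{P}_n| \ge (3^{1/6}-g(n))^{n^2}$ for all $n$.
   Context: An $n$-omino is a collection of $n$ unit squares of the grid that is connected via shared edges. A tiling of the $n\times n$ grid by $n$-ominoes is a partition of its $n^2$ unit squares into $n$ such $n$-ominoes. Equivalently, letting $G_n$ be the $n\times n$ grid graph (vertex set $\{1,\dots,n\}^2$, two vertices adjacent iff they differ by $1$ in exactly one coordinate), $\mathcal{P}_n$ is in bijection with the set of partitions of the vertex set of $G_n$ into $n$ disjoint parts, each inducing a connected subgraph with exactly $n$ vertices. *)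

(* Defs.v *)
From mathcomp Require Import all_boot.

Set Implicit Arguments.
Unset Strict Implicit.
Unset Printing Implicit Defensive.

Local Open Scope nat_scope.

(* Unit squares of the n x n grid, indexed from 0. *)
Definition cell (n : nat) : finType := ('I_n * 'I_n)%type.

Definition dist1 (i j : nat) : bool := (i.+1 == j) || (j.+1 == i).

Definition grid_adj (n : nat) : rel (cell n) :=
  [rel x y : cell n |
    ((x.1 == y.1) && dist1 x.2 y.2) || (dist1 x.1 y.1 && (x.2 == y.2))].

Definition induced (T : finType) (e : rel T) (A : {set T}) : rel T :=
  [rel x y | [&& x \in A, y \in A & e x y]].

Definition connected_in (T : finType) (e : rel T) (A : {set T}) : bool :=
  [forall x in A, forall y in A, connect (induced e A) x y].

Definition omino (n : nat) (A : {set cell n}) : bool :=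
  (#|A| == n) && connected_in (@grid_adj n) A.

Definition tilings (n : nat) : {set {set {set cell n}}} :=
  [set P : {set {set cell n}} |
    [&& partition P [set: cell n], #|P| == n & [forall A in P, omino A]]].

(* Main.v *)
(* Cut the grid into strips of six rows and each strip, read column by column,
   into three segments of 2n cells. In a segment of about n/3 columns two
   combs face each other: one consists of the first full column and rows 2 and
   5, the other of the last full column and rows 0 and 4. Every inner cell of
   rows 1 and 3 touches both combs and can be given to either, subject only to
   both ominoes having n cells. A segment thus admits at least 'C(2m, m)
   choices, where m = n/3 - O(1), and there are n/2 - O(1) segments. As 'C(2m,
   m) grows like 4^m, which exceeds 3^m, the number of tilings is at least
   3^(n^2/6) for all large n, so that g can even be taken to vanish
   eventually. *)

Require Import Defs.
From HB Require Import structures.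
From mathcomp Require Import all_boot all_order all_algebra.
From mathcomp Require Import zify.

Set Implicit Arguments.
Unset Strict Implicit.
Unset Printing Implicit Defensive.

(** * Connectedness by descent to a root *)

(** Following decreasing [mu] inside [A] must end at a root; as [A] has at most one root, any two
    vertices are joined through it. *)
Lemma connected_in_descent (T : finType) (e : rel T) (A : {set T})
    (root : pred T) (mu : T -> nat) :
    symmetric e ->
    {in A &, forall x y, root x -> root y -> x = y} ->
    {in A, forall x, root x \/ exists2 y, y \in A & e x y /\ mu y < mu x} ->
  connected_in e A.
Proof.
move=> esym uniq_root desc.
have toroot m x : mu x < m -> x \in A ->
    exists2 z, (z \in A) && root z & connect (induced e A) x z.
  elim: m x => // m IHm x ltxm xA; have [rx|[y yA [exy ltyx]]] := desc x xA.
    by exists x; rewrite ?xA ?rx ?connect0.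
  have [|z zA cyz] := IHm y _ yA; first by rewrite (leq_trans ltyx).
  exists z => //; apply: connect_trans cyz.
  by apply: connect1; rewrite /induced /= xA yA exy.
have isym : connect_sym (induced e A).
  by apply: sym_connect_sym => x y; rewrite /induced /= esym andbCA.
apply/forall_inP => x xA; apply/forall_inP => y yA.
have [z /andP[zA rz] cxz] := toroot _ x (ltnSn _) xA.
have [w /andP[wA rw] cyw] := toroot _ y (ltnSn _) yA.
by apply: connect_trans cxz _; rewrite isym (uniq_root z w).
Qed.

Lemma grid_adj_sym n : symmetric (@grid_adj n).
Proof.
move=> x y; rewrite /grid_adj /= /dist1 (eq_sym x.1) (eq_sym x.2).
by rewrite (orbC (x.2.+1 == y.2)) (orbC (x.1.+1 == y.1)).
Qed.

(** * Tilings as level sets of labelings *)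

Section Labelings.
Variable n : nat.
Implicit Types (lab : cell n -> nat) (k : nat).

Definition fiber lab k : {set cell n} := [set x | lab x == k].
Definition tiles lab : {set {set cell n}} := [set fiber lab k | k : 'I_n].

Lemma tiles_in_tilings lab :
    (forall x, lab x < n) -> (forall k, k < n -> omino (fiber lab k)) ->
  tiles lab \in tilings n.
Proof.
move=> ltlab om.
have dis : {in 'I_n &, forall i j : 'I_n,
    j != i -> [disjoint fiber lab i & fiber lab j]}.
  move=> i j _ _ neji; rewrite -setI_eq0; apply/eqP/setP => x.
  rewrite !inE; apply/negP => /andP[/eqP-> /eqP eij].
  by rewrite -val_eqE /= eij eqxx in neji.
have n0 : set0 \notin tiles lab.
  apply/imsetP => -[k _ e0]; have /andP[/eqP] := om k (ltn_ord k).
  by have := ltn_ord k; rewrite -e0 cards0; lia.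
have [triv inj] := trivIimset dis n0.
rewrite inE; apply/and3P; split.
- apply/and3P; split => //; rewrite eqEsubset subsetT; apply/subsetP => x _.
  apply/bigcupP; exists (fiber lab (Ordinal (ltlab x))); first exact: imset_f.
  by rewrite inE.
- by rewrite card_in_imset // card_ord.
by apply/forall_inP => _ /imsetP[k _ ->]; apply: om.
Qed.

(* A cell with the same label under both labelings pins down which block is
   which, so that the unlabelled partition determines the labels. *)
Lemma tiles_inj lab1 lab2 :
    (forall x, lab1 x < n) ->
    (forall k, k < n -> exists x, lab1 x = k /\ lab2 x = k) ->
  tiles lab1 = tiles lab2 -> lab1 =1 lab2.
Proof.
move=> ltlab anchor eqt x; have [c [c1 c2]] := anchor _ (ltlab x).
have : fiber lab1 (lab1 x) \in tiles lab2.
  by rewrite -eqt; apply/imsetP; exists (Ordinal (ltlab x)).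
case/imsetP => k _ /setP ek.
have := ek c; have := ek x; rewrite !inE c1 c2 !eqxx => /esym/eqP-> /esym/eqP.
by [].
Qed.

End Labelings.

(** * Counting the choices of swing cells *)

(** By Pascal's rule neither N -> N + 1 nor (N, k) -> (N + 1, k + 1) decreases a binomial; [b - m]
    moves of the first kind and [a - m] of the second lead from one side to the other. *)
Lemma leq_bin_central m a b : m <= a -> m <= b -> 'C(m.*2, m) <= 'C(a + b, a).
Proof.
move=> /subnK<- /subnK<-.
have H1 N k c : 'C(N, k) <= 'C(N + c, k).
  by elim: c => [|c IH]; rewrite ?addn0 // addnS; case: k IH => [|k] IH;
    rewrite ?bin0 // binS (leq_trans IH) ?leq_addr.
have H2 N k c : 'C(N, k) <= 'C(N + c, k + c).
  by elim: c => [|c IH]; rewrite ?addn0 // !addnS binS (leq_trans IH) ?leq_addl.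
rewrite -addnn; apply: leq_trans (H1 _ _ (b - m)) _.
apply: leq_trans (H2 _ _ (a - m)) _.
by apply: eq_leq; congr 'C(_, _); lia.
Qed.

Section Relabelings.
Variables (n P m : nat) (lo hi : cell n -> nat).

(* [lo x] and [hi x] are the two labels allowed for [x]; a swing cell can be
   given to either of the cores [p.*2] and [p.*2.+1]. *)
Definition relabel (S : {set cell n}) x := if x \in S then hi x else lo x.
Definition core k : {set cell n} := [set x | (lo x == k) && (hi x == k)].
Definition swing p : {set cell n} :=
  [set x | (lo x == p.*2) && (hi x == p.*2.+1)].

Hypothesis ltlo : forall x, lo x < n.
Hypothesis lthi : forall x, hi x < n.
Hypothesis lohi : forall x, lo x != hi x -> exists2 p, p < P & x \in swing p.
Hypothesis core_neq0 : forall k, k < n -> exists x, x \in core k.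
Hypothesis conn : forall (S : {set cell n}) k,
  k < n -> connected_in (@grid_adj n) (fiber (relabel S) k).
Hypothesis pair_size : forall p, p < P ->
  #|core p.*2| + #|core p.*2.+1| + #|swing p| = n.*2.
Hypothesis lo_size : forall p, p < P -> #|core p.*2| + m <= n.
Hypothesis hi_size : forall p, p < P -> #|core p.*2.+1| + m <= n.
Hypothesis rest_size : forall k, P.*2 <= k < n -> #|core k| = n.

(** The chosen cells fill the odd core up to [n] cells; by [pair_size] the remaining swing cells
    then fill the even core to [n] as well. *)
Let choices (p : 'I_P) : {set {set cell n}} :=
  [set A : {set cell n} | (A \subset swing p) & #|A| == n - #|core p.*2.+1|].
Let union (f : {ffun 'I_P -> {set cell n}}) := \bigcup_p f p.

Let swing_disj p q x : x \in swing p -> x \in swing q -> p = q.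
Proof. by rewrite !inE => /andP[/eqP-> _] /andP[/eqP + _]; lia. Qed.

Let union_swing f (p : 'I_P) :
  f \in family choices -> union f :&: swing p = f p.
Proof.
move=> /familyP fF; apply/setP => x; rewrite inE; apply/andP/idP => [[]|xf].
  case/bigcupP => q _ xq xp; have := fF q; rewrite inE => /andP[/subsetP sq _].
  by rewrite (val_inj (swing_disj xp (sq _ xq))).
split; first by apply/bigcupP; exists p.
by have := fF p; rewrite inE => /andP[/subsetP/(_ x xf)].
Qed.

Let union_sub f x : f \in family choices -> x \in union f ->
  exists p : 'I_P, x \in swing p.
Proof.
move=> /familyP fF /bigcupP[q _ xq]; have := fF q; rewrite inE => /andP[sq _].
by exists q; apply: (subsetP sq).
Qed.

Let card_fiber f k : f \in family choices -> k < n ->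
  #|fiber (relabel (union f)) k| = n.
Proof.
move=> fF ltkn; set S := union f.
have relabE x : x \in core k -> relabel S x = k.
  by rewrite inE /relabel => /andP[/eqP-> /eqP->]; case: ifP.
have [leK|ltK] := leqP P.*2 k.
  apply: etrans (rest_size (k := k) _); last by rewrite leK.
  apply: eq_card => x.
  apply/idP/idP => [|/relabE xk]; last by rewrite inE xk.
  rewrite !inE /relabel => eqk; have [e|/lohi[p ltp]] := eqVneq (lo x) (hi x).
    by move: eqk; rewrite e if_same => ->.
  rewrite inE => /andP[/eqP e1 /eqP e2]; move: eqk.
  by rewrite e1 e2; case: ifP; lia.
have ltp : k./2 < P by lia.
pose p := Ordinal ltp; have Sp := union_swing p fF.
have := familyP fF p; rewrite inE -Sp => /andP[_ /eqP cardS].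
have [[lop hip] pp] :=
  (lo_size (ltn_ord p), hi_size (ltn_ord p), pair_size (ltn_ord p)).
have inS x : x \in S -> lo x != hi x.
  by case/(union_sub fF) => q; rewrite inE => /andP[/eqP-> /eqP->]; lia.
have [ok|ek] := boolP (odd k).
- have ->: fiber (relabel S) k = core k :|: (S :&: swing p).
    apply/setP => x; rewrite !inE /relabel; have := @inS x.
    have := @lohi x; case: eqVneq => [->|ne /(_ isT)[q _]].
      by case: (x \in S) => [_ /(_ isT)|_ _] //=; rewrite andbb orbF.
    rewrite inE => /andP[/eqP-> /eqP->] _; case: (x \in S) => /=; lia.
  rewrite cardsU cardS; set I := _ :&: _; have -> : I = set0.
    apply/setP => x; rewrite !inE; apply/negP => /andP[/andP[/eqP-> /eqP->]].
    by case/andP=> _ /andP[/eqP + /eqP]; lia.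
  have -> : core k = core p.*2.+1 by congr core; rewrite /p /=; lia.
  by rewrite cards0 subn0 subnKC //; lia.
have ->: fiber (relabel S) k = core k :|: (swing p :\: S).
  apply/setP => x; rewrite !inE /relabel; have := @inS x.
  have := @lohi x; case: eqVneq => [->|ne /(_ isT)[q _]].
    by case: (x \in S) => [_ /(_ isT)|_ _] //=; rewrite andbb; lia.
  rewrite inE => /andP[/eqP-> /eqP->] _; case: (x \in S) => /=; lia.
rewrite cardsU cardsD (setIC (swing p)) cardS; set I := _ :&: _.
have -> : I = set0.
  apply/setP => x; rewrite !inE; apply/negP => /andP[/andP[/eqP-> /eqP->]].
  by case/andP=> _ /andP[/eqP + /eqP]; lia.
have -> : core k = core p.*2 by congr core; rewrite /p /=; lia.
by rewrite cards0 subn0; lia.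
Qed.

(** Core cells keep their label under every choice, so they anchor the blocks and the tiling
    determines the choice. Each pair contributes a binomial whose two parts, the deficits of its
    cores, are at least [m]. *)
Lemma bin_exp_leq_tilings : 'C(m.*2, m) ^ P <= #|tilings n|.
Proof.
pose t f := tiles (relabel (union f)).
have ltlab f x : relabel (union f) x < n by rewrite /relabel; case: ifP.
have tinj : {in family choices &, injective t}.
  move=> f g fF gF /tiles_inj-/(_ (ltlab f)) eqfg.
  have {}eqfg : relabel (union f) =1 relabel (union g).
    apply: eqfg => k /core_neq0[x]; rewrite inE => /andP[/eqP lx /eqP hx].
    by exists x; rewrite /relabel lx hx !if_same.
  apply/ffunP => p; rewrite -(union_swing p fF) -(union_swing p gF).
  apply/setP => x; rewrite !inE; have := eqfg x; rewrite /relabel.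
  case: (x \in union f) (x \in union g) => [] [] //=; lia.
have -> : 'C(m.*2, m) ^ P = \prod_(p : 'I_P) 'C(m.*2, m).
  by rewrite prod_nat_const card_ord.
apply: leq_trans (_ : #|family choices| <= _).
  rewrite card_family foldrE big_map big_enum /=; apply: leq_prod => p _.
  rewrite cards_draws.
  have [[lop hip] pp] :=
    (lo_size (ltn_ord p), hi_size (ltn_ord p), pair_size (ltn_ord p)).
  have -> : #|swing p| = (n - #|core p.*2.+1|) + (n - #|core p.*2|) by lia.
  by apply: leq_bin_central; lia.
rewrite -(card_in_imset tinj); apply: subset_leq_card; apply/subsetP.
move=> _ /imsetP[f fF ->]; apply: tiles_in_tilings => // k ltkn.
by rewrite /omino card_fiber // eqxx conn.
Qed.

End Relabelings.

(** * The comb construction in strips of six rows *)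

(* Within a strip of six rows the cells are ordered column by column, and the
   strip is cut into three segments of [n.*2] consecutive cells. *)
Definition strip_pos (i j : nat) := 6 * j + i %% 6.
Definition seg (n x : nat) : nat := (n.*2 <= x) + (n.*2 + n.*2 <= x).
(* [b] is the position where the segment starts. The left omino owns every
   column up to the first one lying entirely in the segment, as well as rows 2
   and 5; the right omino owns every column from the last full one on, as well
   as rows 0 and 4. What remains of rows 1 and 3 touches both. *)
Definition left_part (n b i j : nat) :=
  (6 * j < b + 6)
  || ((i %% 6 == 2) || (i %% 6 == 5)) && (6 * j + 12 <= b + n.*2).
Definition right_part (n b i j : nat) :=
  (b + n.*2 < 6 * j + 12)
  || ((i %% 6 == 0) || (i %% 6 == 4)) && (b + 6 <= 6 * j).
(* The ominoes of a strip get the labels [6 * t], ..., [6 * t + 5]; the last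
   [n %% 6] rows are ominoes by themselves. *)
Definition strip_label (n i j : nat) (c : bool) :=
  if i < 6 * (n %/ 6) then 6 * (i %/ 6) + 2 * seg n (strip_pos i j) + c else i.
(** The label is odd only on the right part for [lo_label], but everywhere off the left part for
    [hi_label]: a disputed cell goes left under the first and right under the second. *)
Definition lo_label n (x : cell n) :=
  strip_label n x.1 x.2
    (right_part n (n.*2 * seg n (strip_pos x.1 x.2)) x.1 x.2).
Definition hi_label n (x : cell n) :=
  strip_label n x.1 x.2
    (~~ left_part n (n.*2 * seg n (strip_pos x.1 x.2)) x.1 x.2).
(** In a strip, labels 2s and 2s + 1 modulo 6 share segment s: the even one is the left omino, the
    odd one the right. *)
Definition seg_start (n k : nat) := n.*2 * (k %% 6 %/ 2).

Definition in_seg (n k i j : nat) :=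
  (i %/ 6 == k %/ 6) && (seg_start n k <= strip_pos i j < seg_start n k + n.*2).

Lemma strip_labelE n i j c k : i < n -> j < n -> k < 6 * (n %/ 6) ->
  (strip_label n i j c == k) = in_seg n k i j && (odd k == c).
Proof.
move=> ltin ltjn ltk; rewrite /strip_label /in_seg /seg_start.
have s3 : k %% 6 %/ 2 < 3 by lia.
have ltp : strip_pos i j < 6 * n by rewrite /strip_pos; lia.
case: (ltnP i) => lti; last lia.
rewrite /seg; move: (strip_pos i j) ltp => p ltp.
case E: (k %% 6 %/ 2) s3 => [|[|[|s]]] // _;
  case: c; case: (leqP n.*2 p); case: (leqP (n.*2 + n.*2) p); lia.
Qed.

Lemma seg_start_in n k i j :
  i < n -> j < n -> k < 6 * (n %/ 6) -> in_seg n k i j ->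
  n.*2 * seg n (strip_pos i j) = seg_start n k.
Proof.
move=> ltin ltjn ltk; rewrite /in_seg /seg_start.
have : k %% 6 %/ 2 < 3 by lia.
rewrite /seg; move: (strip_pos i j) => p.
case E: (k %% 6 %/ 2) => [|[|[|s]]] // _;
  case: (leqP n.*2 p); case: (leqP (n.*2 + n.*2) p); lia.
Qed.

Lemma lo_labelE n (x : cell n) k : k < 6 * (n %/ 6) ->
  (lo_label x == k)
  = in_seg n k x.1 x.2 && (odd k == right_part n (seg_start n k) x.1 x.2).
Proof.
move=> ltk; rewrite /lo_label strip_labelE //.
have := seg_start_in (ltn_ord x.1) (ltn_ord x.2) ltk.
by case: in_seg => //= ->.
Qed.

Lemma hi_labelE n (x : cell n) k : k < 6 * (n %/ 6) ->
  (hi_label x == k)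
  = in_seg n k x.1 x.2 && (odd k == ~~ left_part n (seg_start n k) x.1 x.2).
Proof.
move=> ltk; rewrite /hi_label strip_labelE //.
have := seg_start_in (ltn_ord x.1) (ltn_ord x.2) ltk.
by case: in_seg => //= ->.
Qed.

Lemma seg_start_leq n k : seg_start n k + n.*2 <= 6 * n.
Proof.
rewrite /seg_start; have : k %% 6 %/ 2 < 3 by lia.
by case: (_ %/ 2) => [|[|[|s]]] // _; lia.
Qed.

(** The bound 9 keeps the end columns apart: a column counted in full on both sides would force 2n <
    18. *)
Lemma left_right n b i j : 9 <= n -> left_part n b i j -> ~~ right_part n b i j.
Proof. rewrite /left_part /right_part; lia. Qed.

Lemma in_coreE n (x : cell n) k : 9 <= n -> k < 6 * (n %/ 6) ->
  (x \in core (@lo_label n) (@hi_label n) k)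
  = in_seg n k x.1 x.2 &&
    (if odd k then right_part n (seg_start n k) x.1 x.2
     else left_part n (seg_start n k) x.1 x.2).
Proof.
move=> len ltk; rewrite inE lo_labelE // hi_labelE //.
have := @left_right n (seg_start n k) x.1 x.2 len.
by case: in_seg; case: (odd k); case: left_part; case: right_part => //= ->.
Qed.

Lemma in_fiber_label n (S : {set cell n}) (x : cell n) k :
    9 <= n -> k < 6 * (n %/ 6) ->
    x \in fiber (relabel (@lo_label n) (@hi_label n) S) k ->
  in_seg n k x.1 x.2 /\
  if odd k
  then right_part n (seg_start n k) x.1 x.2
       || ~~ left_part n (seg_start n k) x.1 x.2
  else left_part n (seg_start n k) x.1 x.2
       || ~~ right_part n (seg_start n k) x.1 x.2.
Proof.
move=> len ltk; rewrite inE /relabel.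
case: (x \in S); rewrite ?lo_labelE ?hi_labelE // => /andP[->];
have := @left_right n (seg_start n k) x.1 x.2 len;
by case: (odd k); case: left_part; case: right_part => //= ->.
Qed.

Lemma core_sub_fiber n lo hi (S : {set cell n}) k :
  core lo hi k \subset fiber (relabel lo hi S) k.
Proof.
apply/subsetP => x; rewrite !inE /relabel => /andP[/eqP-> /eqP->].
by rewrite if_same.
Qed.

(** * Connectedness of the ominoes *)

(** The root is the top cell of the first full column [c]. Cells of the left part move along their
    row towards [c], then up that column. A swing cell, in row 1 or 3, moves to row 2 of the comb;
    the value 10 exceeds every row residue, so this lowers [mu]. *)
Lemma even_descent n k i j :
    9 <= n -> k < 6 * (n %/ 6) -> ~~ odd k -> i < n -> j < n ->
    in_seg n k i j ->
    left_part n (seg_start n k) i j || ~~ right_part n (seg_start n k) i j ->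
  let c := (seg_start n k + 5) %/ 6 in
  let mu i j := 20 * ((j - c) + (c - j)) +
     (if left_part n (seg_start n k) i j then i %% 6 else 10) in
  i = 6 * (k %/ 6) /\ j = c \/
  exists i' j', [/\ i' < n, j' < n,
    in_seg n k i' j' && left_part n (seg_start n k) i' j',
    (i == i') && dist1 j j' || dist1 i i' && (j == j') & mu i' j' < mu i j].
Proof.
move=> len ltk evk ltin ltjn.
rewrite /in_seg /left_part /right_part /strip_pos /dist1.
have := seg_start_leq n k.
move: (seg_start n k) => b leb /andP[/eqP eqt inb] part.
set c := (b + 5) %/ 6.
have bc : 6 * c <= b + 5 < 6 * c + 6 by rewrite /c; lia.
move: c bc => c bc.
case: (ltngtP j c) => [ltjc|ltcj|ejc].
- right; exists i, j.+1; rewrite (_ : _ || _ = true); last lia.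
  rewrite (_ : _ || _ = true); last lia.
  split; lia.
- case: (boolP ((i %% 6 == 2) || (i %% 6 == 5))) part => [i25 part|ni part].
    right; exists i, j.-1; rewrite (_ : (6 * j < _) || _ = true); last lia.
    rewrite (_ : _ || _ = true); last lia.
    split; lia.
  have [i1|i3] : i %% 6 = 1 \/ i %% 6 = 3 by lia.
    right; exists i.+1, j.
    rewrite (_ : (6 * j < _) || false && _ = false);
      last lia.
    by rewrite (_ : (6 * j < _) || _ = true); first split; lia.
  right; exists i.-1, j.
  rewrite (_ : (6 * j < _) || false && _ = false);
    last lia.
  by rewrite (_ : (6 * j < _) || _ = true); first split; lia.
case: (posnP (i %% 6)) => [i0|ipos]; first by left; lia.
right; exists i.-1, j; have -> : 6 * j < b + 6 by lia.
by rewrite /=; split; lia.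
Qed.

(** Mirror image, with [c] the last full column: swing cells of row 1 move up to row 0, those of row
    3 down to row 4. *)
Lemma odd_descent n k i j :
    9 <= n -> k < 6 * (n %/ 6) -> odd k -> i < n -> j < n ->
    in_seg n k i j ->
    right_part n (seg_start n k) i j || ~~ left_part n (seg_start n k) i j ->
  let c := ((seg_start n k + n.*2) %/ 6).-1 in
  let mu i j := 20 * ((j - c) + (c - j)) +
     (if right_part n (seg_start n k) i j then i %% 6 else 10) in
  i = 6 * (k %/ 6) /\ j = c \/
  exists i' j', [/\ i' < n, j' < n,
    in_seg n k i' j' && right_part n (seg_start n k) i' j',
    (i == i') && dist1 j j' || dist1 i i' && (j == j') & mu i' j' < mu i j].
Proof.
move=> len ltk evk ltin ltjn.
rewrite /in_seg /left_part /right_part /strip_pos /dist1.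
have := seg_start_leq n k.
move: (seg_start n k) => b leb /andP[/eqP eqt inb] part.
set c := ((b + n.*2) %/ 6).-1.
have bc : 6 * c + 6 <= b + n.*2 < 6 * c + 12 by rewrite /c; lia.
move: c bc => c bc.
case: (ltngtP c j) => [ltjc|ltcj|ejc].
- right; exists i, j.-1; rewrite (_ : _ || _ = true); last lia.
  rewrite (_ : _ || _ = true); last lia.
  split; lia.
- case: (boolP ((i %% 6 == 0) || (i %% 6 == 4))) part => [i25 part|ni part].
    right; exists i, j.+1; rewrite (_ : (_ < 6 * j + 12) || _ = true); last lia.
    rewrite (_ : _ || _ = true); last lia.
    split; lia.
  have [i1|i3] : i %% 6 = 1 \/ i %% 6 = 3 by lia.
    right; exists i.-1, j.
    rewrite (_ : (_ < 6 * j + 12) || false && _ = false);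
      last lia.
    by rewrite (_ : (_ < 6 * j + 12) || _ = true); first split; lia.
  right; exists i.+1, j.
  rewrite (_ : (_ < 6 * j + 12) || false && _ = false);
    last lia.
  by rewrite (_ : (_ < 6 * j + 12) || _ = true); first split; lia.
case: (posnP (i %% 6)) => [i0|ipos]; first by left; lia.
right; exists i.-1, j; have -> : b + n.*2 < 6 * j + 12 by lia.
by rewrite /=; split; lia.
Qed.

Lemma seg_leq2 n x : seg n x <= 2.
Proof. by rewrite /seg; do 2 case: (_ <= x). Qed.

Lemma strip_label_rest n i j c k : j < n -> 6 * (n %/ 6) <= k ->
  (strip_label n i j c == k) = (i == k).
Proof.
move=> ltjn lek; rewrite /strip_label; case: ltnP => // lti.
by have := seg_leq2 n (strip_pos i j); case: c; lia.
Qed.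

Lemma in_core_rest n (x : cell n) k : 6 * (n %/ 6) <= k ->
  (x \in core (@lo_label n) (@hi_label n) k) = (x.1 == k :> nat).
Proof. by move=> lek; rewrite inE !strip_label_rest // andbb. Qed.

Lemma in_fiber_rest n (S : {set cell n}) (x : cell n) k : 6 * (n %/ 6) <= k ->
  (x \in fiber (relabel (@lo_label n) (@hi_label n) S) k) = (x.1 == k :> nat).
Proof.
by move=> lek; rewrite inE /relabel; case: ifP; rewrite !strip_label_rest.
Qed.

Lemma cell_eqP n (x y : cell n) :
  x.1 = y.1 :> nat -> x.2 = y.2 :> nat -> x = y.
Proof. by case: x y => x1 x2 [y1 y2] /= /val_inj-> /val_inj->. Qed.

Lemma fiber_connected n (S : {set cell n}) k : 9 <= n -> k < n ->
  connected_in (@grid_adj n) (fiber (relabel (@lo_label n) (@hi_label n) S) k).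
Proof.
move=> len ltkn; set A := fiber _ _.
have [lek|ltk] := leqP (6 * (n %/ 6)) k.
  apply: (@connected_in_descent (cell n) _ _ (fun x => x.2 == 0 :> nat)
    (fun x => x.2 : nat)); first exact: grid_adj_sym.
    move=> x y; rewrite !in_fiber_rest // => /eqP x1 /eqP y1 /eqP x2 /eqP y2.
    by apply: cell_eqP; rewrite ?x1 ?x2.
  move=> x xA; have [x0|xpos] := posnP x.2; first by left; apply/eqP.
  have lt2 : x.2.-1 < n by have := ltn_ord x.2; lia.
  right; exists (x.1, Ordinal lt2); first by move: xA; rewrite !in_fiber_rest.
  by rewrite /grid_adj /= eqxx /dist1 /= prednK // eqxx orbT.
pose part :=
  if odd k then right_part n (seg_start n k) else left_part n (seg_start n k).
pose c :=
  if odd k then ((seg_start n k + n.*2) %/ 6).-1 else (seg_start n k + 5) %/ 6.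
pose mu i j := 20 * ((j - c) + (c - j)) + (if part i j then i %% 6 else 10).
apply: (@connected_in_descent (cell n) _ _
   (fun x => (x.1 == 6 * (k %/ 6) :> nat) && (x.2 == c :> nat))
   (fun x => mu x.1 x.2)); first exact: grid_adj_sym.
  move=> x y _ _ /andP[/eqP x1 /eqP x2] /andP[/eqP y1 /eqP y2].
  by apply: cell_eqP; rewrite ?x1 ?x2.
move=> x /in_fiber_label-/(_ len ltk)[xseg xpart].
have : (x.1 = 6 * (k %/ 6) :> nat /\ x.2 = c :> nat) \/
  exists i' j', [/\ i' < n, j' < n, in_seg n k i' j' && part i' j',
    (x.1 == i' :> nat) && dist1 x.2 j' || dist1 x.1 i' && (x.2 == j' :> nat)
    & mu i' j' < mu x.1 x.2].
  rewrite /mu /c /part; case: ifP xpart => [oddk|/negbT evk] xpart.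
    exact: odd_descent.
  exact: even_descent.
case=> [[-> ->]|[i [j [lti ltj yA adj ltmu]]]]; [by left; rewrite !eqxx|right].
exists (Ordinal lti, Ordinal ltj) => //.
(* Each descent lands in a core cell, which lies in the omino whatever [S] is. *)
apply: (subsetP (core_sub_fiber _ _ _ _)); rewrite in_coreE //=.
by move: yA; rewrite /part; case: ifP.
Qed.

Lemma core_neq0 n k : 9 <= n -> k < n ->
  exists x, x \in core (@lo_label n) (@hi_label n) k.
Proof.
move=> len ltkn; have [lek|ltk] := leqP (6 * (n %/ 6)) k.
  have n0 : 0 < n by lia.
  by exists (Ordinal ltkn, Ordinal n0); rewrite in_core_rest.
pose c :=
  if odd k then ((seg_start n k + n.*2) %/ 6).-1 else (seg_start n k + 5) %/ 6.
have lei : 6 * (k %/ 6) < n by lia.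
have lec : c < n by rewrite /c; have := seg_start_leq n k; case: ifP; lia.
exists (Ordinal lei, Ordinal lec); rewrite in_coreE //= /in_seg /strip_pos /c.
by rewrite /left_part /right_part; case: ifP => _; lia.
Qed.

(** * Sizes of segments, cores and swing sets *)

Section CardCode.
Variables (T : finType) (A : {set T}) (code : T -> nat) (N : nat).
Hypothesis code_inj : {in A &, injective code}.
Hypothesis code_lt : {in A, forall x, code x < N}.

Lemma card_code_leq : #|A| <= N.
Proof.
rewrite cardE -(size_map code) -[N](size_iota 0); apply: uniq_leq_size.
  rewrite map_inj_in_uniq ?enum_uniq // => x y.
  by rewrite !mem_enum; exact: code_inj.
by move=> _ /mapP[x + ->]; rewrite mem_enum mem_iota => /code_lt.
Qed.

Lemma card_code_eq : (forall u, u < N -> exists2 x, x \in A & code x = u) ->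
  #|A| = N.
Proof.
move=> code_surj; apply/eqP; rewrite eqn_leq card_code_leq /=.
rewrite cardE -(size_map code) -[X in X <= _](size_iota 0).
apply: uniq_leq_size (iota_uniq _ _) _ => u.
by rewrite mem_iota => /code_surj[x xA <-]; rewrite map_f ?mem_enum.
Qed.

End CardCode.

Lemma card_core_rest n k : 6 * (n %/ 6) <= k < n ->
  #|core (@lo_label n) (@hi_label n) k| = n.
Proof.
case/andP=> lek ltkn.
apply: (@card_code_eq (cell n) _ (fun x => x.2 : nat)) => //.
  move=> x y; rewrite !in_core_rest // => /eqP x1 /eqP y1.
  by apply: cell_eqP; rewrite x1 y1.
move=> u ltu; exists (Ordinal ltkn, Ordinal ltu) => //.
by rewrite in_core_rest.
Qed.

Lemma card_seg n k : 9 <= n -> k < 6 * (n %/ 6) ->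
  #|[set x : cell n | in_seg n k x.1 x.2]| = n.*2.
Proof.
move=> len ltk; have leb := seg_start_leq n k.
apply: (@card_code_eq (cell n) _ (fun x => strip_pos x.1 x.2 - seg_start n k)).
- move=> x y; rewrite !inE /in_seg /strip_pos => xs ys exy.
  by apply: cell_eqP; lia.
- by move=> x; rewrite inE /in_seg; lia.
move=> u ltu; have lti : 6 * (k %/ 6) + (seg_start n k + u) %% 6 < n by lia.
have ltj : (seg_start n k + u) %/ 6 < n by lia.
by exists (Ordinal lti, Ordinal ltj); rewrite ?inE /= /in_seg /strip_pos; lia.
Qed.

(** At most two columns, the full one and a partial one beside it, count with up to six cells each
    and get the codes below 12. Each of the other columns, at most [n %/ 3] in number, adds the two
    cells of its teeth. *)
Lemma card_core n k : 9 <= n -> k < 6 * (n %/ 6) ->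
  #|core (@lo_label n) (@hi_label n) k| <= 12 + 2 * (n %/ 3).
Proof.
move=> len ltk; have leb := seg_start_leq n k.
have [oddk|evk] := boolP (odd k).
  pose c := ((seg_start n k + n.*2) %/ 6).-1.
  pose code (x : cell n) := if seg_start n k + n.*2 < 6 * x.2 + 12
    then 6 * (x.2 - c) + x.1 %% 6 else 12 + 2 * (c - x.2).-1 + (x.1 %% 6 == 4).
  apply: (@card_code_leq _ _ code) => [x y|x].
    rewrite !in_coreE // oddk /in_seg /right_part /strip_pos => xs ys.
    rewrite /code /c; case: ifP => xl; case: ifP => yl exy;
      by apply: cell_eqP; lia.
  rewrite !in_coreE // oddk /in_seg /right_part /strip_pos /code /c => xs.
  by case: ifP => xl; lia.
pose c := (seg_start n k + 5) %/ 6.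
pose code (x : cell n) := if 6 * x.2 < seg_start n k + 6
  then 6 * (c - x.2) + x.1 %% 6 else 12 + 2 * (x.2 - c).-1 + (x.1 %% 6 == 5).
apply: (@card_code_leq _ _ code) => [x y|x].
  rewrite !in_coreE // (negPf evk) /in_seg /left_part /strip_pos => xs ys.
  rewrite /code /c; case: ifP => xl; case: ifP => yl exy;
    by apply: cell_eqP; lia.
rewrite !in_coreE // (negPf evk) /in_seg /left_part /strip_pos /code /c => xs.
by case: ifP => xl; lia.
Qed.

Lemma in_seg_double n p i j : in_seg n p.*2.+1 i j = in_seg n p.*2 i j.
Proof.
rewrite /in_seg /seg_start (_ : p.*2.+1 %/ 6 = p.*2 %/ 6); last lia.
by rewrite (_ : p.*2.+1 %% 6 %/ 2 = p.*2 %% 6 %/ 2) //; lia.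
Qed.

Lemma seg_start_double n p : seg_start n p.*2.+1 = seg_start n p.*2.
Proof.
by rewrite /seg_start (_ : p.*2.+1 %% 6 %/ 2 = p.*2 %% 6 %/ 2) //; lia.
Qed.

Lemma pair_card n p : 9 <= n -> p < 3 * (n %/ 6) ->
  #|core (@lo_label n) (@hi_label n) p.*2|
  + #|core (@lo_label n) (@hi_label n) p.*2.+1|
  + #|swing (@lo_label n) (@hi_label n) p| = n.*2.
Proof.
move=> len ltp.
have [lt0 lt1] : p.*2 < 6 * (n %/ 6) /\ p.*2.+1 < 6 * (n %/ 6) by lia.
rewrite -(card_seg len lt0); set D := [set x | _].
rewrite -(cardsID (core (@lo_label n) (@hi_label n) p.*2) D) -addnA.
congr (_ + _).
  apply: eq_card => x; rewrite in_setI in_coreE // inE odd_double.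
  by case: in_seg.
rewrite -(cardsID (core (@lo_label n) (@hi_label n) p.*2.+1) (D :\: _)).
congr (_ + _); apply: eq_card => x.
  rewrite !in_setI !in_setD !in_coreE // inE /= odd_double.
  rewrite in_seg_double seg_start_double.
  have := @left_right n (seg_start n p.*2) x.1 x.2 len.
  by case: in_seg; case: left_part; case: right_part => //= ->.
rewrite !in_setD !in_coreE // !inE lo_labelE // hi_labelE //=.
rewrite odd_double in_seg_double seg_start_double.
have := @left_right n (seg_start n p.*2) x.1 x.2 len.
by case: in_seg; case: left_part; case: right_part => //= ->.
Qed.

Lemma strip_label_lt n i j (c : bool) : i < n -> strip_label n i j c < n.
Proof.
move=> ltin; rewrite /strip_label; case: (ltnP i (6 * _)) => // lti.
by have := seg_leq2 n (strip_pos i j); case: c; lia.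
Qed.

Lemma bin_leq_tilings n : 36 <= n ->
  'C((n %/ 3 - 12).*2, n %/ 3 - 12) ^ (3 * (n %/ 6)) <= #|tilings n|.
Proof.
move=> len; have len9 : 9 <= n by lia.
(* With [36 <= n] the subtraction of 12 is not truncated, and it cancels the 12 in [card_core]. *)
have sz k : k < 6 * (n %/ 6) ->
    #|core (@lo_label n) (@hi_label n) k| + (n %/ 3 - 12) <= n.
  by move=> /(card_core len9); lia.
apply: (@bin_exp_leq_tilings _ _ _ (@lo_label n) (@hi_label n)).
- by move=> x; apply: strip_label_lt.
- by move=> x; apply: strip_label_lt.
- move=> x; rewrite /lo_label /hi_label => ne.
  have [lti|lei] := ltnP x.1 (6 * (n %/ 6)); last first.
    by rewrite /strip_label ltnNge lei eqxx in ne.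
  have segx := seg_leq2 n (strip_pos x.1 x.2).
  exists (3 * (x.1 %/ 6) + seg n (strip_pos x.1 x.2)); first lia.
  move: ne; rewrite inE /lo_label /hi_label /strip_label lti.
  have := @left_right n (n.*2 * seg n (strip_pos x.1 x.2)) x.1 x.2 len9.
  by case: left_part; case: right_part => //= H ne; lia.
- by move=> k; apply: core_neq0.
- by move=> S k; apply: fiber_connected.
- by move=> p; apply: pair_card.
- by move=> p ltp; apply: sz; lia.
- by move=> p ltp; apply: sz; lia.
- by move=> k ltk; apply: card_core_rest; lia.
Qed.

(** * Growth of central binomials against powers of 3 *)

Lemma central_binS m :
  m.+1 * 'C(m.+1.*2, m.+1) = 2 * m.*2.+1 * 'C(m.*2, m).
Proof.
have sym : 'C(m.*2.+1, m.+1) = 'C(m.*2.+1, m).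
  by rewrite -bin_sub; [congr 'C(_, _)|]; lia.
rewrite doubleS binS -sym addnn -muln2 mulnA -mul_bin_diag /=.
by rewrite mulnC mulnA.
Qed.

(** The ratio 2(2m + 1)/(m + 1) of successive central binomials is at least 7/2 once m is at least
    3; the factor 4 covers the small cases. The rate 7/2 suffices later because its square 49/4
    exceeds 12. *)
Lemma central_bin_lb m : 7 ^ m <= 4 * 2 ^ m * 'C(m.*2, m).
Proof.
elim: m => [|m IHm]; first by rewrite bin0.
have [le3|] := leqP 3 m; last by case: m IHm => [|[|[|]]].
rewrite -(leq_pmul2l (ltn0Sn m)) mulnCA central_binS !expnS.
have := leq_mul (leqnn (2 * (2 * m.*2.+1))) IHm.
move: (7 ^ m) (2 ^ m) 'C(_, _) => u v w le1.
apply: leq_trans (_ : 2 * (2 * m.*2.+1) * u <= _); last by nia.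
by rewrite mulnA leq_mul2r; apply/orP; right; lia.
Qed.

(* 243 = 3 ^ 5 and 256 = 4 ^ 4: growth [12 ^ 4 = 81 * 256] of the eighth power
   of the central binomials, against [3 ^ 9 = 81 * 243]. *)
Lemma geometric_dominates K :
  exists M, forall m, M <= m -> K * 243 ^ m <= 256 ^ m.
Proof.
(* Bernoulli's inequality for (1 + 13/243)^m, cleared of denominators. *)
have bernoulli m : (243 + 13 * m) * 243 ^ m <= 243 * 256 ^ m.
  elim: m => [|m]; first by rewrite muln0 addn0.
  by rewrite !expnS; move: (243 ^ m) (256 ^ m) => u v; nia.
exists (243 * K) => m leM; rewrite -(leq_pmul2l (m := 243)) // mulnA.
apply: leq_trans (bernoulli m); rewrite leq_mul2r; apply/orP; right; lia.
Qed.

(** The fourth power of 12^m <= 16 B^2 gives 256^m 3^(4m) <= 16^4 B^8, while 3^(9m) = 243^m 3^(4m).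
    The exponent 9 against 8 leaves slack for rounding [n] to multiples of 6 and 3; the shift 13
    makes 3(m + 13) at least [n] for [m = n %/ 3 - 12]. *)
Lemma exp3_central_bin :
  exists M, forall m, M <= m -> 3 ^ (9 * (m + 13)) <= 'C(m.*2, m) ^ 8.
Proof.
have [M HM] := geometric_dominates (16 ^ 4 * 3 ^ (9 * 13)).
exists M => m /HM leK; set B := 'C(_, _).
have le12 : 4 ^ m * 3 ^ m <= 16 * B ^ 2.
  rewrite -(leq_pmul2l (m := 4 ^ m)) ?expn_gt0 //.
  apply: leq_trans (_ : (7 ^ m) ^ 2 <= _).
    rewrite -!expnMn -expnM [m * 2]mulnC expnM.
    by have [->|m0] := posnP m; rewrite ?expn0 ?leq_exp2r.
  apply: leq_trans (_ : (4 * 2 ^ m * B) ^ 2 <= _).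
    by rewrite leq_exp2r // central_bin_lb.
  rewrite !expnMn -(expnM 2) [m * 2]mulnC (expnM 2 2) (_ : 2 ^ 2 = 4) //.
  by rewrite -mulnA mulnCA.
have : (4 ^ m * 3 ^ m) ^ 4 <= (16 * B ^ 2) ^ 4 by rewrite leq_exp2r.
rewrite !expnMn -!expnM (mulnC m) (expnM 4) (_ : 4 ^ 4 = 256) // => le4.
rewrite -(leq_pmul2l (m := 16 ^ 4)) ?expn_gt0 // (expnD B 4 4).
apply: leq_trans le4.
rewrite mulnDr (expnD 3 (9 * m)) (_ : 9 * m = 5 * m + 4 * m); last lia.
rewrite (expnD 3 (5 * m)) (expnM 3 5) (_ : 3 ^ 5 = 243) //.
move: leK; move: (16 ^ 4) (3 ^ (9 * 13)) (243 ^ m) (256 ^ m) (3 ^ (4 * m)).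
by move=> a b c d e leK; nia.
Qed.

Lemma exp3_leq_tilings :
  exists N, forall n, N <= n -> 3 ^ (n ^ 2) <= #|tilings n| ^ 6.
Proof.
have [M HM] := exp3_central_bin.
exists (3 * M + 100) => n leN; have len : 36 <= n by lia.
pose q := n %/ 6; pose m := n %/ 3 - 12.
have [leq6 lem] : n <= 6 * q + 5 /\ n <= 3 * (m + 13) by rewrite /q /m; lia.
have /HM leB : M <= m by rewrite /m; lia.
have leT := bin_leq_tilings len; rewrite -/q -/m in leT.
have leT6 : ('C(m.*2, m) ^ (3 * q)) ^ 6 <= #|tilings n| ^ 6.
  by rewrite leq_exp2r.
(* Raised to the eighth power, the claim reduces to 8n^2 <= 162q(m + 13), which follows from n <=
   3(m + 13) and 24n <= 162q. *)
apply: leq_trans leT6; rewrite -(leq_exp2r _ _ (ltn0Sn 7)) -!expnM.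
rewrite (_ : 3 * q * (6 * 8) = 8 * (18 * q)); last lia.
rewrite (expnM _ 8 (18 * q)).
apply: leq_trans (_ : (3 ^ (9 * (m + 13))) ^ (18 * q) <= _); last first.
  by rewrite leq_exp2r // /q; lia.
rewrite -expnM leq_exp2l // -mulnn.
have le1 : n * n <= n * (3 * (m + 13)) by rewrite leq_mul2l lem orbT.
have le2 : 24 * n <= 162 * q by lia.
have := leq_mul le2 (leqnn (m + 13)).
by move: (m + 13) le1 => v; nia.
Qed.

(* Passage to the real statement *)
(* Imported only here because classical_sets shadows the finite set notions. *)
From mathcomp Require Import all_classical all_reals all_analysis.

Import Order.TTheory GRing.Theory Num.Theory.
Import numFieldNormedType.Exports.
Local Open Scope classical_set_scope.
Local Open Scope ring_scope.

Theorem theorem2 (R : realType) :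
  exists g : nat -> R,
    (g n @[n --> \oo] --> (0 : R)) /\
    forall n : nat,
      (3%:R `^ (6%:R^-1) - g n) ^+ (n ^ 2) <= #|tilings n|%:R.
Proof.
have [N leN] := exp3_leq_tilings.
set c : R := 3%:R `^ 6%:R^-1.
(* Below [N] the base becomes 0, and from [N] on the error is exactly 0. *)
exists (fun n => if (n < N)%N then c else 0); split.
  apply: cvg_near_cst; exists N => // n /= leNn.
  by rewrite ltnNge leNn.
move=> n; case: ltnP => [ltnN|/leN leT].
  rewrite subrr expr0n; case: n ltnN => [|n] _; last by rewrite ler0n.
  (* For [n = 0] the left side is 0^0 = 1, matched by the empty tiling. *)
  rewrite ler1n card_gt0; apply/set0Pn; exists (tiles (fun x : cell 0 => 0%N)).
  by apply: tiles_in_tilings => // -[[]].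
have c0 : 0 <= c by apply: powR_ge0.
have c6 : c ^+ 6 = 3%:R.
  by rewrite -powR_mulrn // -powRrM mulVf ?pnatr_eq0 // powRr1.
rewrite subr0 -(ler_pXn2r (isT : (0 < 6)%N)) ?nnegrE ?exprn_ge0 //.
by rewrite -exprM mulnC exprM c6 -!natrX ler_nat.
Qed.
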